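(* Let $n$ be an odd positive integer which is not a prime power (i.e. $n$ is divisible by at least two distinct primes). Then for any positive integers $k$ and $d$ there exists a $D_n$-equivariant map $(D_n/H)^{\ast k}\to S(\hat{\rho}^{\,d})$.
   Context: $D_n=\langle x,y\mid x^n=y^2=1,\ yx=x^{-1}y\rangle$ is the dihedral group of order $2n$ and $H=\langle y\rangle$. $(D_n/H)^{\ast k}$ is the $k$-fold join of the discrete $D_n$-set $D_n/H$ with the diagonal action. $\hat\rho$ is the restriction to $D_n$ of the standard representation $\{v\in\mathbb{R}^n:\sum v_i=0\}$ of $\Sigma_n$, where $D_n\subset\Sigma_n$ via its action on the $n$-element set $\{1,\dots,n\}\cong D_n/H$; $\hat\rho^{\,d}$ is the direct sum of $d$ copies. For an orthogonal representation $V$, $S(V)=\{v\in V:\|v\|=1\}$ with the induced action. Equivariant maps are continuous. *)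

(* Defs.v *)
From HB Require Import structures.
From mathcomp Require Import all_boot all_order all_algebra all_fingroup.
From mathcomp Require Import all_solvable generic_quotient.
From mathcomp Require Import all_classical all_reals.
From mathcomp Require Import topology.

Set Implicit Arguments.
Unset Strict Implicit.
Unset Printing Implicit Defensive.

Import Order.TTheory GRing.Theory Num.Theory.
Import numFieldTopology.Exports.

Local Open Scope classical_set_scope.
Local Open Scope ring_scope.

(* The library indexes dihedral groups by their order. *)
Notation dihedral n := (dihedral_gtype n.*2).

Section LeftCosets.
Variables (gT : finGroupType) (H : {set gT}).

Definition lcoset_space : Type :=
  {C : {set gT} | C \in lcosets H [set: gT]%SET}.

HB.instance Definition _ := Finite.on lcoset_space.
HB.instance Definition _ :=
  DiscreteTopology.copy lcoset_space (discrete_topology lcoset_space).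

Lemma lcoset_in_space (g : gT) (C : lcoset_space) :
  lcoset (val C) g \in lcosets H [set: gT]%SET.
Proof.
have /lcosetsP[x _ ->] := valP C.
by apply/lcosetsP; exists (g * x)%g; rewrite ?inE ?lcosetE ?lcosetM.
Qed.

(* left translation g . (a H) = (g a) H *)
Definition lcoset_act (g : gT) (C : lcoset_space) : lcoset_space :=
  Sub (lcoset (val C) g) (lcoset_in_space g C).

Lemma lcoset_act_inj (g : gT) : injective (lcoset_act g).
Proof.
move=> C D /(congr1 val) /= CD; apply/val_inj => /=.
by rewrite -[val C](lcosetK g) -[val D](lcosetK g) -!lcosetE CD.
Qed.

(* The permutation of {0, .., n-1} by which g acts on H-cosets, once these are
   numbered by the bijection e with inverse e'. Permutations compose from left
   to right in the library, so this is an antimorphism to 'S_n. *)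
Definition coset_perm (n : nat) (e : 'I_n -> lcoset_space)
    (e' : lcoset_space -> 'I_n) (eK : cancel e e') (e'K : cancel e' e)
    (g : gT) : 'S_n :=
  perm (inj_comp (can_inj e'K) (inj_comp (lcoset_act_inj (g := g)) (can_inj eK))).

End LeftCosets.

Section Join.
Variables (R : realType) (X : topologicalType) (k : nat).

Definition simplex : set 'rV[R]_k :=
  [set t | (forall i, 0 <= t 0 i) /\ \sum_i t 0 i = 1].

(* pairs (t, x) standing for the formal sum t_0 x_0 + ... + t_(k-1) x_(k-1) *)
Definition prejoin : Type := (set_type simplex * {ptws 'I_k -> X})%type.

HB.instance Definition _ := Topological.on prejoin.

Definition join_eq (p q : prejoin) : bool :=
  `[< val p.1 = val q.1 /\
      forall i, val p.1 0 i != 0 -> p.2 i = q.2 i >].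

Lemma join_eq_equiv : equiv_class_of join_eq.
Proof.
have join_eq_sym p q : join_eq p q -> join_eq q p.
  by move=> /asboolP[e h]; apply/asboolP; split=> // i; rewrite -e => /h.
split=> [p|p q|q p r].
- exact/asboolP.
- by apply/idP/idP; exact: join_eq_sym.
- move=> /asboolP[e1 h1] /asboolP[e2 h2]; apply/asboolP.
  by rewrite e1; split=> // i hi; rewrite h1 ?e1 // h2.
Qed.

Canonical join_equiv := EquivRelPack join_eq_equiv.

Definition join : Type := quotient_topology {eq_quot join_equiv}%qT.

HB.instance Definition _ := Topological.on join.
HB.instance Definition _ := Quotient.on join.

Definition prejoin_map (f : X -> X) (p : prejoin) : prejoin :=
  (p.1, fun i => f (p.2 i)).

Definition join_map (f : X -> X) (z : join) : join :=
  (\pi_join (prejoin_map f (repr z)))%qT.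

Lemma join_map_pi (f : X -> X) (p : prejoin) :
  join_map f (\pi_join p)%qT = (\pi_join (prejoin_map f p))%qT.
Proof.
have pi_join (q r : prejoin) : (\pi_join q = \pi_join r)%qT <-> join_eq q r.
  by split=> [/(@eqmodP _ join_equiv)|] // h; exact/(@eqmodP _ join_equiv).
have /pi_join/asboolP[e h] : (\pi_join (repr (\pi_join p : join)) = \pi_join p)%qT.
  by rewrite reprK.
by apply/pi_join/asboolP; split=> // i /h /= ->.
Qed.

End Join.

Arguments simplex R k : clear implicits.

Section Representation.
Variables (R : realType) (d n : nat).

Definition std_rep : set 'rV[R]_n := [set v | \sum_i v 0 i = 0].

(* the direct sum of d copies of R^n is the space of d x n matrices, each row
   being one of the d components *)
Definition std_rep_sum : set 'M[R]_(d, n) :=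
  [set v | forall a, std_rep (row a v)].

Definition euclid_norm (v : 'M[R]_(d, n)) : R :=
  Num.sqrt (\sum_a \sum_i v a i ^+ 2).

Definition unit_vectors : set 'M[R]_(d, n) :=
  [set v | std_rep_sum v /\ euclid_norm v = 1].

Definition sphere : Type := set_type unit_vectors.

HB.instance Definition _ := Topological.on sphere.

(* (s . v)_i = v_(s^-1 i) in each component, i.e. s maps the i-th basis vector
   to the (s i)-th one *)
Definition perm_coord (s : 'S_n) (v : 'M[R]_(d, n)) : 'M[R]_(d, n) :=
  col_perm s^-1%g v.

Lemma perm_coord_sphere (s : 'S_n) (v : sphere) :
  perm_coord s (val v) \in unit_vectors.
Proof.
have [v0 v1] := set_mem (valP v); apply/mem_set; split.
  move=> a; rewrite /std_rep /= -[RHS](v0 a) (reindex_inj (@perm_inj _ s)).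
  by apply: eq_bigr => i _; rewrite !mxE permK.
rewrite -v1 /euclid_norm; congr Num.sqrt; apply: eq_bigr => a _.
rewrite (reindex_inj (@perm_inj _ s)).
by apply: eq_bigr => i _; rewrite !mxE permK.
Qed.

Definition sphere_act (s : 'S_n) (v : sphere) : sphere :=
  exist _ (perm_coord s (val v)) (perm_coord_sphere s v).

End Representation.

Arguments std_rep R n : clear implicits.
Arguments std_rep_sum R d n : clear implicits.
Arguments unit_vectors R d n : clear implicits.
Arguments sphere_act R d {n} s v.

Definition equivariant_map (G : Type) (X Y : topologicalType)
    (aX : G -> X -> X) (aY : G -> Y -> Y) (f : X -> Y) : Prop :=
  continuous f /\ forall g x, f (aX g x) = aY g (f x).

(* Main.v *)
Require Import Defs.
From mathcomp Require Import all_boot all_order all_algebra all_fingroup.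
From mathcomp Require Import all_solvable generic_quotient.
From mathcomp Require Import all_classical all_reals topology.
From mathcomp Require Import normedtype matrix_normedtype realfun complex.
From mathcomp Require Import ring lra zify.

(** Let p and q be distinct primes dividing n, and let V = C^2, on which x
    multiplies the first coordinate by a nontrivial p-th root of unity a and
    the second by a nontrivial q-th root of unity b, while y conjugates both.
    Sending v to the function i |-> Re (v_1 conj(a^i)) + Re (v_2 conj(b^i)) on
    the cosets embeds V equivariantly into the representation rho-hat, so an
    equivariant map from the join to V minus the origin is enough.

    All k are treated at once. Suppose given a continuous Psi : V x R+ -> V
    that vanishes only at the origin, commutes with conjugation, and whose
    restriction Psi(-, 0) also commutes with x. Then
    Phi(v, s, gH) = g Psi (g^-1 v, s) is well defined and equivariant, and for
    s = 0 it does not depend on the coset. Hence folding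
    v |-> Phi(v, t_i, x_i) over the terms of a formal sum t_1 x_1 + ... + t_k x_k,
    starting from v = 0, defines a map on the join, and it has no zero because
    some t_i is positive ([join_step], [join_fold]).

    In topological terms, Psi is an equivariant self-map of the sphere of V
    together with an H-equivariant null-homotopy of it; this is where two
    primes are needed. Choose N = 0 mod p with N = 1 mod q, and write M = N - 1.
    The sphere is the join of the circles of z and of w. Let the self-map run
    along the join coordinate through the points
      (z^-M, 0), (0, w), (z, 0), (0, w^N).
    The congruences make each of them equivariant, and the degree is
    (1 - N) - 1 + N = 0. The null-homotopy has three stages.
    - The second point is moved from (0, w) to (0, w z^M), so that the first
      two pieces become diag(1, z^M) applied to what they were.
    - The last piece, (z, w) |-> (z, w^N), is (z, w) |-> (z^N, w) conjugated by
      a quarter turn of the coordinate plane; undoing the turn gradually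
      deforms the former into the latter. On the other pieces diag(1, z^M) is
      diag(z^M, 1) conjugated by the same quarter turn, and undoing this one
      as well keeps the pieces together at their common point (z, 0). Now
      the points are (1, 0), (0, w), (z^N, 0), (0, w).
    - The second coordinate has become w times a nonnegative real, and a
      straight line leads to the constant (1, 0).
    The map Psi below ([cone_map]) is this homotopy written with polynomials in
    z, w, conj(z) and nonnegative real weights; [cone_map_eq0] says that it
    has no zero but the origin. *)

Set Implicit Arguments.
Unset Strict Implicit.
Unset Printing Implicit Defensive.
Import Order.TTheory GRing.Theory Num.Theory.
Import numFieldNormedType.Exports.

Section Construction.
Local Open Scope ring_scope.
Local Open Scope complex_scope.
Local Notation "z ^*" := (conjc z) : ring_scope.
Local Notation Re := complex.Re.
Local Notation Im := complex.Im.

(** * The null-homotopy and its zeros *)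

Section Homotopy.
Variables (R : realType) (M : nat).
Implicit Types (Z W : R[i]).

(** Conventions for the weights, all of them nonnegative reals. The triple
    x, m, y is a coordinate along the join of the two circles, with x = 0 or
    y = 0: the points z^-M, w, z lie over y = 0 (at m = 0, in the middle, and
    at x = 0) and z, w^N lie over x = 0 (at y = 0 and m = 0). The pairs
    (l0, l1), (t0, t1), (u0, u1) are homogeneous times for the three stages;
    stage one deforms from l1 = 0 to l0 = 0 with t0 = 0, stage two from t0 = 0
    to t1 = 0, stage three from u1 = 0 to u0 = 0. *)
Section Weights.
Variables (x m y l0 l1 t0 t1 : R[i]).

(** The two coordinates before turning back, that is, before the matrix with
    rows (t0, -t1) and (t1, t0) is applied. For x = 0 they are the coordinates of
    the turned vector (m Z, y W), the first one raised to the power N. For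
    y = l0 = 0 they are, up to the nonnegative factors t0^M (x + m^M) and l1 in
    its first row, the matrix diag(Z^M, 1) applied to the turned vector
    (x conj(Z)^M + m Z, x m W). *)
Definition unturned1 Z W : R[i] :=
  (t0 * (m * Z) + t1 * (y * W)) ^+ M.+1
  + x * (t0 ^+ M.+1 * ((x + m ^+ M) * (Z ^+ M * Z^* ^+ M) + m * Z ^+ M.+1)
         + t1 * m * (l0 + l1 * Z ^+ M) * W).

Definition unturned2 Z W : R[i] :=
  t0 * ((x * m + y) * W) - t1 * (x * Z^* ^+ M + m * Z).

(** The two halves of the join coordinate, in terms of |Z|^2 and |W|^2. *)
Definition collar Z W :=
  (x = 0 /\ (m = Z * Z^* /\ y = W * W^* - Z * Z^*)) \/
  (0 < x /\ [/\ x = Z * Z^* - W * W^*, m = W * W^* & y = 0]).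

Lemma mulcJ_eq0 Z : (Z * Z^* == 0) = (Z == 0).
Proof. by rewrite mulf_eq0 conjc_eq0 orbb. Qed.

Lemma conjc_id (a : R[i]) : a \is Num.real -> a^* = a.
Proof. by move=> /complex_realP[k ->]; rewrite conjc_real. Qed.

Lemma turn_eq0 (a b : R[i]) : 0 <= t0 -> 0 <= t1 -> (t0 != 0) || (t1 != 0) ->
  t0 * a + t1 * b = 0 -> t0 * b - t1 * a = 0 -> a = 0 /\ b = 0.
Proof.
move=> t0p t1p tn e1 e2.
have n0 : t0 ^+ 2 + t1 ^+ 2 != 0.
  by rewrite paddr_eq0 ?exprn_ge0 // !expf_eq0 /= negb_and.
split; apply: (mulfI n0); rewrite mulr0.
  have -> : (t0 ^+ 2 + t1 ^+ 2) * a
    = t0 * (t0 * a + t1 * b) - t1 * (t0 * b - t1 * a) by ring.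
  by rewrite e1 e2 !mulr0 subr0.
have -> : (t0 ^+ 2 + t1 ^+ 2) * b
  = t1 * (t0 * a + t1 * b) + t0 * (t0 * b - t1 * a) by ring.
by rewrite e1 e2 !mulr0 addr0.
Qed.

(** No zeros in the first two stages, given in this order by the two cases of
    the hypothesis. Over x = 0 the turning matrix is invertible. Over y = 0 the
    second stage applies to the vector (x conj(Z)^M + m Z, x m W) a matrix
    whose determinant is Z^M times a positive real, and in the first stage a
    zero would force both Z^M < 0 and Z > 0. *)
Lemma unturned_eq0 Z W :
    (t0 = 0 /\ 0 < l0 /\ 0 <= l1 /\ 0 < t1) \/
    (l0 = 0 /\ 0 < l1 /\ 0 <= t0 /\ 0 <= t1 /\ ((t0 != 0) || (t1 != 0))) ->
  collar Z W ->
  unturned1 Z W = 0 -> unturned2 Z W = 0 -> Z = 0 /\ W = 0.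
Proof.
have innerE : x = 0 -> m = Z * Z^* -> y = W * W^* - Z * Z^* ->
   m * Z = 0 -> y * W = 0 -> Z = 0 /\ W = 0.
  move=> _ -> -> /eqP; rewrite mulf_eq0 mulcJ_eq0 orbb => /eqP ->.
  rewrite mul0r subr0 => /eqP; rewrite mulf_eq0 mulcJ_eq0 orbb => /eqP ->.
  by split.
have outerE : 0 < x -> x = Z * Z^* - W * W^* -> m = W * W^* ->
   x * Z^* ^+ M + m * Z = 0 -> m * W = 0 -> Z = 0 /\ W = 0.
  move=> x0 xE mE + /eqP.
  rewrite mE mulf_eq0 mulcJ_eq0 orbb => + /eqP W0.
  rewrite W0 !mul0r addr0 => /eqP.
  rewrite mulf_eq0 expf_eq0 conjc_eq0 (gt_eqF x0) /= => /andP[_ /eqP ->].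
  by split.
move=> wt [[x0 [mE yE]]|[x0 [xE mE y0]]]; rewrite /unturned1 /unturned2.
  rewrite x0 !mul0r addr0 !add0r => /eqP; rewrite expf_eq0 /= => /eqP e1 e2.
  have [] := turn_eq0 _ _ _ e1 e2; [| | |exact: innerE].
  - by case: wt => [[-> //]|[_ [_ []]]].
  - by case: wt => [[_ [_ [_ /ltW]]]|[_ [_ [_ []]]]].
  - by case: wt => [[_ [_ [_ /gt_eqF->]]]|[_ [_ [_ []]]]//]; rewrite orbT.
have Z0 : Z != 0.
  apply/eqP => z0; move: x0; rewrite xE z0 mul0r sub0r oppr_gt0.
  by move=> /lt_geF; rewrite mulcJ_ge0.
have ZM0 : Z ^+ M != 0 by rewrite expf_neq0.
have xn0 : x != 0 by rewrite gt_eqF.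
have m_ge0 : 0 <= m by rewrite mE mulcJ_ge0.
case: wt => [[t00 [l0p [l1p t1p]]]|[l00 [l1p [t0p [t1p tn]]]]].
  have t1n : t1 != 0 by rewrite gt_eqF.
  rewrite y0 t00 !mul0r !mulr0 addr0 expr0n /= ?mul0r !add0r ?sub0r.
  move=> /eqP; rewrite !mulf_eq0 (negPf xn0) (negPf t1n) /= => A0.
  move=> /eqP; rewrite oppr_eq0 mulf_eq0 (negPf t1n) /= => /eqP P0.
  apply: outerE => //.
  case/orP: A0 => [/orP[/eqP->|/eqP lZ]|/eqP->]; rewrite ?mul0r ?mulr0 //.
  have [->|mn] := eqVneq m 0; first by rewrite mul0r.
  have mp : 0 < m by rewrite lt_def mn.
  have l1n : l1 != 0.
    by apply/eqP => l10; move: lZ; rewrite l10 mul0r addr0 => l0E;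
      rewrite l0E ltxx in l0p.
  (* Here Z^M is a negative real, so the vanishing of x conj(Z)^M + m Z makes Z
     a positive real, a contradiction. *)
  have ZME : Z ^+ M = - (l0 / l1).
    apply: (mulfI l1n); rewrite mulrN mulrCA divff // mulr1.
    by apply/eqP; rewrite -addr_eq0 addrC lZ.
  have l_gt0 : 0 < l0 / l1 by rewrite divr_gt0 // lt_def l1n.
  have ZJM : Z^* ^+ M = - (l0 / l1).
    by rewrite -rmorphXn ZME; apply: conjc_id; rewrite realN ger0_real // ltW.
  have : 0 <= Z ^+ M.
    apply: exprn_ge0; rewrite -(pmulr_rge0 _ mp).
    move: P0; rewrite ZJM mulrN addrC => /eqP; rewrite subr_eq0 => /eqP ->.
    by rewrite mulr_ge0 ?ltW.
  by rewrite ZME oppr_ge0 => /le_gtF; rewrite l_gt0.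
set P0 := x * Z^* ^+ M + m * Z; set kap := t0 ^+ M * (x + m ^+ M).
rewrite l00 add0r y0 !mul0r mulr0 !addr0 => A0 B0.
have kap_ge0 : 0 <= kap by rewrite mulr_ge0 ?exprn_ge0 // addr_ge0 ?exprn_ge0 // ltW.
(* Determinant of the system A1, B0 for the unknowns P0 and x m W. *)
have d0 : kap * t0 ^+ 2 + t1 ^+ 2 * l1 != 0.
  have h1 : 0 <= kap * t0 ^+ 2 by rewrite mulr_ge0 // exprn_ge0.
  have h2 : 0 <= t1 ^+ 2 * l1 by rewrite mulr_ge0 ?exprn_ge0 // ltW.
  rewrite (paddr_eq0 h1 h2).
  apply/negP => /andP[]; rewrite !mulf_eq0 !expf_eq0 /= (gt_eqF l1p) orbF.
  have kx0 : x + m ^+ M != 0 by rewrite gt_eqF // ltr_pwDl // exprn_ge0.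
  rewrite (negPf kx0) orbF !orbb => + /eqP t10.
  by move: tn; rewrite t10 eqxx orbF => /negPf ->; rewrite andbF.
have A1 : kap * t0 * P0 + t1 * l1 * (x * m * W) = 0.
  apply: (mulfI ZM0); rewrite mulr0 -[RHS]A0 /kap /P0.
  by rewrite !exprMn !exprS; ring.
have PE : P0 = 0.
  apply: (mulfI d0); rewrite mulr0.
  have -> : (kap * t0 ^+ 2 + t1 ^+ 2 * l1) * P0
    = t0 * (kap * t0 * P0 + t1 * l1 * (x * m * W))
      - t1 * l1 * (t0 * (x * m * W) - t1 * P0) by ring.
  by rewrite A1 B0 !mulr0 subr0.
apply: outerE => //; apply: (mulfI xn0); rewrite mulr0 mulrA.
apply: (mulfI d0); rewrite mulr0.
have -> : (kap * t0 ^+ 2 + t1 ^+ 2 * l1) * (x * m * W)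
  = t1 * (kap * t0 * P0 + t1 * l1 * (x * m * W))
    + kap * t0 * (t0 * (x * m * W) - t1 * P0) by ring.
by rewrite A1 B0 !mulr0 addr0.
Qed.
End Weights.
End Homotopy.

Section Psi.
Variables (R : realType) (M : nat).
Implicit Types (Z W : R[i]) (s : R) (v : R[i] * R[i]).

Definition normsq Z : R := Re Z ^+ 2 + Im Z ^+ 2.

Lemma normsqE Z : (normsq Z)%:C = Z * Z^*.
Proof. by rewrite /normsq add_Re2_Im2 sqr_normc. Qed.

Lemma normsq_ge0 Z : 0 <= normsq Z.
Proof. by rewrite addr_ge0 // sqr_ge0. Qed.

Lemma normsqJ Z : normsq Z^* = normsq Z.
Proof. by rewrite /normsq; case: Z => a b /=; rewrite sqrrN. Qed.

Lemma normsqM Z W : normsq (Z * W) = normsq Z * normsq W.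
Proof. by apply: complexI; rewrite rmorphM /= !normsqE rmorphM /=; ring. Qed.

Lemma normsq_unit (a : R[i]) : a * a^* = 1 -> normsq a = 1.
Proof. by move=> a1; apply: complexI; rewrite normsqE a1. Qed.

(** For |v| small against s the value is the constant (1, 0) up to scale, and
    for s = 0 it is the equivariant self-map. The parameter s passes through
    the three stages during [0, r], [r, 2r] and [2r, 3r], where r measures v;
    homogeneous times make the formula continuous at the origin as well. The
    term u1 m W lifts the point (z^N, 0) off the first axis during the last
    stage, since the segment from z^N to 1 may pass through 0. *)
Definition cone_map v s : R[i] * R[i] :=
  let rho := normsq v.1 in let sg := normsq v.2 in
  let r := Num.max rho sg in
  let x := (Num.max (rho - sg) 0)%:C in
  let m := (Num.min rho sg)%:C in
  let y := (Num.max (sg - rho) 0)%:C in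
  let l0 := (Num.max (r - s) 0)%:C in
  let l1 := (Num.min r s)%:C in
  let t0 := (Num.max (s - r) 0)%:C in
  let t1 := (Num.max (2 * r - s) 0)%:C in
  let u0 := (Num.max (3 * r - s) 0)%:C in
  let u1 := (Num.max (s - 2 * r) 0)%:C in
  let A := unturned1 M x m y l0 l1 t0 t1 v.1 v.2 in
  let B := unturned2 M x m y t0 t1 v.1 v.2 in
  (u0 * (t0 * A - t1 * B) + u1, u0 * (t1 * A + t0 * B + u1 * m * v.2)).

Lemma collar_weights Z W : let rho := normsq Z in let sg := normsq W in
  collar (Num.max (rho - sg) 0)%:C (Num.min rho sg)%:C (Num.max (sg - rho) 0)%:C Z W.
Proof.
move=> rho sg; rewrite /collar -!normsqE -/rho -/sg.
have [le|lt] := leP rho sg; [left|right].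
  rewrite (max_idPr _) ?subr_le0 // (max_idPl _) ?subr_ge0 //.
  by rewrite rmorphB.
rewrite (max_idPl _) ?subr_ge0 ?(ltW lt) // (max_idPr _) ?subr_le0 ?(ltW lt) //.
by rewrite (ltcR 0) subr_gt0 lt rmorphB.
Qed.

(** In the first two stages the matrix with rows (t0, -t1), (t1, t0) is
    invertible, and [unturned_eq0] applies. In the third stage t1 = 0: the
    second coordinate is W times a nonnegative real that vanishes only if
    W = 0, and for W = 0 the first coordinate is positive. *)
Lemma cone_map_eq0 v s : 0 <= s -> cone_map v s = 0 -> v = 0 /\ s = 0.
Proof.
case: v => Z W s0; rewrite /cone_map /=.
have := collar_weights Z W; cbv zeta.
set rho := normsq Z; set sg := normsq W; set r := Num.max rho sg.
set x := Num.max (rho - sg) 0; set m := Num.min rho sg.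
set y := Num.max (sg - rho) 0 => bnd.
have rho0 : 0 <= rho by exact: normsq_ge0.
have sg0 : 0 <= sg by exact: normsq_ge0.
have r_ge0 : 0 <= r by rewrite le_max rho0.
have rE0 : r = 0 -> Z = 0 /\ W = 0.
  move=> rz; have : rho <= 0 /\ sg <= 0 by rewrite -rz !le_max !lexx orbT.
  move=> [rl sl].
  have : (rho == 0) && (sg == 0) by rewrite !eq_le rl sl rho0 sg0.
  move=> /andP[/eqP h1 /eqP h2]; split; apply/eqP; rewrite -mulcJ_eq0 -normsqE.
    by rewrite -/rho h1.
  by rewrite -/sg h2.
have rE0E : Z = 0 /\ W = 0 -> r = 0.
  by rewrite /r /rho /sg /normsq => -[-> ->]; rewrite /= !expr0n /= addr0 maxxx.
have t0_ge0 : 0 <= (Num.max (s - r) 0)%:C by rewrite (lecR 0) le_max lexx orbT.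
have [sr|sr] := leP s (2 * r).
  have -> : Num.max (s - 2 * r) 0 = 0 by apply/max_idPr; lra.
  have u0E : Num.max (3 * r - s) 0 = 3 * r - s by apply/max_idPl; lra.
  have t1E : Num.max (2 * r - s) 0 = 2 * r - s by apply/max_idPl; lra.
  rewrite u0E t1E !mul0r !addr0 => -[e1 e2].
  have [rz|rn] := eqVneq r 0.
    have [-> ->] := rE0 rz; split=> //; apply/eqP; rewrite eq_le s0.
    by move: sr; rewrite rz mulr0 => ->.
  have r_gt0 : 0 < r by rewrite lt_def rn.
  have un : (3 * r - s)%:C != 0 by rewrite (inj_eq (@complexI R)) gt_eqF //; lra.
  move: e1 e2 => /eqP; rewrite mulf_eq0 (negPf un) /= => /eqP e1.
  move=> /eqP; rewrite mulf_eq0 (negPf un) /= => /eqP e2.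
  have t1_ge0 : 0 <= (2 * r - s)%:C by rewrite (lecR 0); lra.
  have t_neq0 : ((Num.max (s - r) 0)%:C != 0) || ((2 * r - s)%:C != 0).
    rewrite !(inj_eq (@complexI R) _ 0); have [le|lt] := leP s r.
      by rewrite orbC gt_eqF //; lra.
    have -> : Num.max (s - r) 0 = s - r by apply/max_idPl; lra.
    by rewrite gt_eqF //; lra.
  suff /rE0E /eqP : Z = 0 /\ W = 0 by rewrite (negPf rn).
  have := turn_eq0 t0_ge0 t1_ge0 t_neq0 _ _.
  set A := unturned1 _ _ _ _ _ _ _ _ _ _ in e1 e2 *.
  set B := unturned2 _ _ _ _ _ _ _ _ in e1 e2 *.
  move=> /(_ A (- B)) [].
  - by rewrite mulrN.
  - by rewrite mulrN -opprD addrC e2 oppr0.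
  move=> A0 /eqP; rewrite oppr_eq0 => /eqP B0.
  apply: (unturned_eq0 _ bnd A0 B0).
  have [lt|le] := ltP s r; [left|right].
    have -> : Num.max (s - r) 0 = 0 by apply/max_idPr; lra.
    have -> : Num.max (r - s) 0 = r - s by apply/max_idPl; lra.
    rewrite !(ltcR 0) (lecR 0).
    by do !split => //; lra.
  have -> : Num.max (r - s) 0 = 0 by apply/max_idPr; lra.
  rewrite (ltcR 0).
  by do !split.
have u1E : Num.max (s - 2 * r) 0 = s - 2 * r by apply/max_idPl; lra.
have t1E : Num.max (2 * r - s) 0 = 0 by apply/max_idPr; lra.
have t0E : Num.max (s - r) 0 = s - r by apply/max_idPl; lra.
have u1p : 0 < s - 2 * r by lra.
have l0E : Num.max (r - s) 0 = 0 by apply/max_idPr; lra.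
rewrite u1E t1E t0E l0E.
have [u0E|u0p] := leP (3 * r - s) 0.
  by rewrite mul0r add0r => -[/eqP]; rewrite gt_eqF.
have t0p : 0 < (s - r)%:C by rewrite (ltcR 0); lra.
have m_ge0 : 0 <= m%:C by rewrite (lecR 0) le_min rho0.
have x_ge0 : 0 <= x%:C by rewrite (lecR 0) le_max lexx orbT.
have y_ge0 : 0 <= y%:C by rewrite (lecR 0) le_max lexx orbT.
rewrite /unturned1 /unturned2 !mul0r !subr0 !addr0 add0r => -[e1 e2].
have {e2} /eqP : W * ((s - r)%:C ^+ 2 * (x%:C * m%:C + y%:C)
     + (s - 2 * r)%:C * m%:C) = 0.
  have un : (3 * r - s)%:C != 0 by rewrite gt_eqF // (ltcR 0).
  by apply: (mulfI un); rewrite mulr0 -[RHS]e2; ring.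
rewrite mulf_eq0 => W0.
have {W0} W0 : W = 0.
  case/orP: W0 => [/eqP //|]; rewrite paddr_eq0; last first.
  - by rewrite mulr_ge0 // (lecR 0) ltW.
  - by rewrite mulr_ge0 ?exprn_ge0 ?(ltW t0p) // addr_ge0 // mulr_ge0.
  have u1n : (s - 2 * r)%:C != 0 by rewrite gt_eqF // (ltcR 0).
  rewrite mulf_eq0 expf_eq0 /= (gt_eqF t0p) mulf_eq0 (negPf u1n) /=.
  move=> /andP[+ /eqP mE]; rewrite mE mulr0 add0r.
  move: mE => /complexI mE /eqP /complexI yE.
  apply/eqP; rewrite -mulcJ_eq0 -normsqE -/sg.
  suff -> : sg = 0 by [].
  rewrite -mE; apply/esym/min_idPr; rewrite -subr_le0 -yE /y.
  by rewrite le_max lexx.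
have sgE : sg = 0 by rewrite /sg W0 /normsq /= expr0n addr0.
have mE : m = 0 by rewrite /m sgE; apply/min_idPr.
move: e1; rewrite mE !mul0r mulr0 expr0n /= !addr0 add0r => /eqP.
rewrite gt_eqF // ltr_wpDl ?(ltcR 0) //.
rewrite mulr_ge0 ?(ltW t0p) ?(lecR 0) ?(ltW u0p) //.
rewrite mulr_ge0 ?(ltW t0p) // mulr_ge0 // mulr_ge0 //.
  by rewrite exprn_ge0 // ltW.
by rewrite mulr_ge0 ?addr_ge0 // -?exprMn ?exprn_ge0 ?mulcJ_ge0.
Qed.
End Psi.

(** * Symmetries and the fold over a join *)

Section Phi.
Variables (R : realType) (M : nat).
Local Notation C := R[i].
Local Notation C2 := (R[i] * R[i])%type.
Implicit Types (Z W : R[i]) (s : R) (v a : C2).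

(* Versions of the morphism laws stated for conjc itself, so that one rewrite
   rule distributes conjugation over polynomial expressions. *)
Lemma conjcD : {morph (@conjc R) : z w / z + w}.
Proof. exact: rmorphD. Qed.
Lemma conjcN : {morph (@conjc R) : z / - z}.
Proof. exact: rmorphN. Qed.
Lemma conjcM : {morph (@conjc R) : z w / z * w}.
Proof. exact: rmorphM. Qed.
Lemma conjcX n : {morph (@conjc R) : z / z ^+ n}.
Proof. exact: rmorphXn. Qed.
Let conjcE := (conjcD, conjcN, conjcM, conjcX, conjc_real, conjcK).

Lemma unturned1J (x m y l0 l1 t0 t1 : R) Z W :
  unturned1 M x%:C m%:C y%:C l0%:C l1%:C t0%:C t1%:C Z^* W^* =
  (unturned1 M x%:C m%:C y%:C l0%:C l1%:C t0%:C t1%:C Z W)^*.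
Proof. by rewrite /unturned1 !conjcE. Qed.

Lemma unturned2J (x m y t0 t1 : R) Z W :
  unturned2 M x%:C m%:C y%:C t0%:C t1%:C Z^* W^* =
  (unturned2 M x%:C m%:C y%:C t0%:C t1%:C Z W)^*.
Proof. by rewrite /unturned2 !conjcE. Qed.

Lemma cone_mapJ v s : cone_map M (v.1^*, v.2^*) s = ((cone_map M v s).1^*, (cone_map M v s).2^*).
Proof.
rewrite /cone_map /= !normsqJ unturned1J unturned2J.
by rewrite !conjcE.
Qed.

(** Pairs (a, b) of unit complex numbers for which both conj(a)^M = a and
    b^N = b; these are the identities that make each point of the self-map
    equivariant. *)
Definition rotation a :=
  [/\ a.1 * a.1^* = 1, a.2 * a.2^* = 1, a.1 ^+ M.+1 = 1 & a.2 ^+ M = 1].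

Lemma cone_map_rotation a v : rotation a ->
  cone_map M (a.1 * v.1, a.2 * v.2) 0 = (a.1 * (cone_map M v 0).1, a.2 * (cone_map M v 0).2).
Proof.
case: a v => a b [Z W] [/= a1 b1 aN bM].
have aJ : a^* ^+ M = a.
  apply: (@mulfI _ (a ^+ M)); first by apply: contra_eq_neq aN => a0;
    rewrite exprS a0 mulr0 eq_sym oner_eq0.
  by rewrite -exprMn a1 expr1n -exprSr aN.
have bN : b ^+ M.+1 = b by rewrite exprS bM mulr1.
rewrite /cone_map /= !normsqM (normsq_unit a1) (normsq_unit b1) !mul1r.
set rho := normsq Z; set sg := normsq W; set r := Num.max rho sg.
have r_ge0 : 0 <= r by rewrite le_max normsq_ge0.
have -> : Num.min r 0 = 0 by apply/min_idPr.
have -> : Num.max (0 - r) 0 = 0 by apply/max_idPr; lra.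
have -> : Num.max (0 - 2 * r) 0 = 0 by apply/max_idPr; lra.
rewrite /unturned1 /unturned2 conjcM !mul0r !addr0 !add0r !exprMn aJ bN !expr0n /= !mul0r !add0r.
by congr (_, _); ring: bN aJ.
Qed.

(* Otherwise simplification would expand projections of cone_map. *)
#[local] Opaque cone_map.

(** The vector Phi(v, s, gH) for a coset gH on which the rotation part of g is
    multiplication by a. *)
Definition join_step a v s : C2 :=
  (a.1 * (cone_map M (a.1^* * v.1, a.2^* * v.2) s).1,
   a.2 * (cone_map M (a.1^* * v.1, a.2^* * v.2) s).2).

Lemma mulfI_unit (a z : C) : a * a^* = 1 -> a * z = 0 -> z = 0.
Proof. by move=> a1 az; rewrite -[z]mul1r -a1 mulrAC az mul0r. Qed.

Lemma join_step_eq0 a v s : rotation a -> 0 <= s -> join_step a v s = 0 -> v = 0 /\ s = 0.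
Proof.
case: a v => a b [Z W] [/= a1 b1 _ _] s0; rewrite /join_step.
set w := cone_map M _ s => e0.
have z0 : w.1 = 0 := mulfI_unit a1 (congr1 fst e0).
have w0 : w.2 = 0 := mulfI_unit b1 (congr1 snd e0).
have E : w = 0 by rewrite [w]surjective_pairing z0 w0.
have [[h1 h2] ->] := cone_map_eq0 s0 E.
split=> //; congr (_, _).
  by apply: (@mulfI_unit a^*); rewrite // conjcK mulrC.
by apply: (@mulfI_unit b^*); rewrite // conjcK mulrC.
Qed.

(** Equivariance of the self-map is exactly what makes a term with
    coefficient 0 independent of its coset, as the join requires. *)
Lemma join_step0 a v : rotation a -> join_step a v 0 = cone_map M v 0.
Proof.
case: a v => a b [Z W] [/= a1 b1 aN bM]; rewrite /join_step /=.
have rJ : rotation (a^*, b^*).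
  by split; rewrite /= ?conjcK 1?mulrC // -conjcX ?aN ?bM conjc1.
have /= -> := cone_map_rotation (Z, W) rJ.
by rewrite !mulrA a1 b1 !mul1r -surjective_pairing.
Qed.

Definition conj_if (c : bool) (z : C) := if c then z^* else z.

(** The isometries of C^2 by which the dihedral group acts: conjugation if c
    holds, followed by multiplication by a. *)
Definition twist (c : bool) a v : C2 := (a.1 * conj_if c v.1, a.2 * conj_if c v.2).

Lemma conj_ifM c : {morph conj_if c : x y / x * y}.
Proof. by case: c => x y //=; rewrite conjcM. Qed.

Lemma conj_ifJ c x : (conj_if c x)^* = conj_if c x^*.
Proof. by case: c. Qed.

(** The reflection part of a twist is absorbed by the conjugation symmetry of
    cone_map, and its rotation part cancels against the one undone inside
    [join_step]. *)
Lemma join_step_twist c g a v s : g.1 * g.1^* = 1 -> g.2 * g.2^* = 1 ->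
  join_step (twist c g a) (twist c g v) s = twist c g (join_step a v s).
Proof.
case: g a v => g h [a b] [Z W] /= g1 h1; rewrite /join_step /twist /=.
have E (u x y : C) : u * u^* = 1 -> (u * conj_if c x)^* * (u * conj_if c y) = conj_if c (x^* * y).
  move=> u1; rewrite conjcM conj_ifJ conj_ifM.
  by rewrite mulrACA [u^* * u]mulrC u1 mul1r.
rewrite !E //.
have -> : cone_map M (conj_if c (a^* * Z), conj_if c (b^* * W)) s =
   (conj_if c (cone_map M (a^* * Z, b^* * W) s).1, conj_if c (cone_map M (a^* * Z, b^* * W) s).2).
  by case: c {E} => /=; [exact: (cone_mapJ (_, _)) | rewrite -surjective_pairing].
by rewrite /= !conj_ifM !mulrA.
Qed.

Implicit Types (ts : seq (R * C2)).

Definition join_fold ts : C2 := foldl (fun v p => join_step p.2 v p.1) 0 ts.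

Lemma join_fold_rcons ts p : join_fold (rcons ts p) = join_step p.2 (join_fold ts) p.1.
Proof. by rewrite /join_fold foldl_rcons. Qed.

Lemma join_fold_eq0 ts : (forall p, p \in ts -> 0 <= p.1 /\ rotation p.2) ->
  join_fold ts = 0 -> forall p, p \in ts -> p.1 = 0.
Proof.
elim/last_ind: ts => // ts p IH H; rewrite join_fold_rcons => e0 q.
have [p0 pr] : 0 <= p.1 /\ rotation p.2 by apply: H; rewrite mem_rcons mem_head.
have [/IH{}IH pE] := join_step_eq0 pr p0 e0.
rewrite mem_rcons inE => /orP[/eqP -> //|]; apply: IH => p' p'ts.
by apply: H; rewrite mem_rcons inE p'ts orbT.
Qed.

Lemma join_fold_twist c g ts : g.1 * g.1^* = 1 -> g.2 * g.2^* = 1 ->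
  join_fold [seq (p.1, twist c g p.2) | p <- ts] = twist c g (join_fold ts).
Proof.
move=> g1 g2; elim/last_ind: ts => [|ts p IH].
  by rewrite /join_fold /twist /= /conj_if conjc0 if_same !mulr0.
by rewrite map_rcons !join_fold_rcons IH /= join_step_twist.
Qed.

Lemma join_fold_ext (I : Type) (s : seq I) (t : I -> R) (a b : I -> C2) :
  (forall i, rotation (a i)) -> (forall i, rotation (b i)) ->
  (forall i, t i != 0 -> a i = b i) ->
  join_fold [seq (t i, a i) | i <- s] = join_fold [seq (t i, b i) | i <- s].
Proof.
move=> ra rb ab; elim/last_ind: s => [//|s i IH].
rewrite !map_rcons !join_fold_rcons IH /=.
by have [->|/ab -> //] := eqVneq (t i) 0; rewrite !join_step0.
Qed.
End Phi.

(** * Continuity *)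

Section Continuity.
Variables (R : realType) (X : topologicalType).
Local Notation C := R[i].
Implicit Types (f g : X -> R) (z w : X -> C).

Lemma ctsD f g : continuous f -> continuous g -> continuous (fun x => f x + g x).
Proof. by move=> cf cg x; apply: continuousD; [exact: cf|exact: cg]. Qed.
Lemma ctsN f : continuous f -> continuous (fun x => - f x).
Proof. by move=> cf x; apply: continuousN; exact: cf. Qed.
Lemma ctsM f g : continuous f -> continuous g -> continuous (fun x => f x * g x).
Proof. by move=> cf cg x; apply: continuousM; [exact: cf|exact: cg]. Qed.
Lemma ctsV f : (forall x, f x != 0) -> continuous f ->
  continuous (fun x => (f x)^-1).
Proof. by move=> f0 cf x; apply: continuousV; [exact: f0|exact: cf]. Qed.
Lemma cts_max f g : continuous f -> continuous g ->
  continuous (fun x => Num.max (f x) (g x)).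
Proof. by move=> cf cg x; apply: continuous_max; [exact: cf|exact: cg]. Qed.
Lemma cts_min f g : continuous f -> continuous g ->
  continuous (fun x => Num.min (f x) (g x)).
Proof. by move=> cf cg x; apply: continuous_min; [exact: cf|exact: cg]. Qed.
Lemma cts_cst (a : R) : continuous (fun _ : X => a).
Proof. by move=> x; exact: cvg_cst. Qed.

Definition cplx_cts z := continuous (fun x => Re (z x)) /\ continuous (fun x => Im (z x)).

Lemma ReD (a b : C) : Re (a + b) = Re a + Re b.
Proof. by case: a; case: b. Qed.
Lemma ImD (a b : C) : Im (a + b) = Im a + Im b.
Proof. by case: a; case: b. Qed.
Lemma cplx_ctsD z w : cplx_cts z -> cplx_cts w -> cplx_cts (fun x => z x + w x).
Proof.
move=> [z1 z2] [w1 w2]; split.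
  under eq_fun do rewrite ReD.
  exact: ctsD.
under eq_fun do rewrite ImD.
exact: ctsD.
Qed.
Lemma ReN (a : C) : Re (- a) = - Re a.
Proof. by case: a. Qed.
Lemma ImN (a : C) : Im (- a) = - Im a.
Proof. by case: a. Qed.
Lemma cplx_ctsN z : cplx_cts z -> cplx_cts (fun x => - z x).
Proof.
move=> [z1 z2]; split; [under eq_fun do rewrite ReN|under eq_fun do rewrite ImN];
  exact: ctsN.
Qed.
Lemma ReM (a b : C) : Re (a * b) = Re a * Re b - Im a * Im b.
Proof. by case: a; case: b. Qed.
Lemma ImM (a b : C) : Im (a * b) = Re a * Im b + Im a * Re b.
Proof. by case: a; case: b. Qed.
Lemma cplx_ctsM z w : cplx_cts z -> cplx_cts w -> cplx_cts (fun x => z x * w x).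
Proof.
move=> [z1 z2] [w1 w2]; split.
  under eq_fun do rewrite ReM.
  by apply: ctsD; [exact: ctsM|apply: ctsN; exact: ctsM].
under eq_fun do rewrite ImM.
by apply: ctsD; exact: ctsM.
Qed.
Lemma cplx_ctsX n z : cplx_cts z -> cplx_cts (fun x => z x ^+ n).
Proof.
move=> cz; elim: n => [|n IH].
  under [X in cplx_cts X]eq_fun do rewrite expr0.
  by split; exact: cts_cst.
under [X in cplx_cts X]eq_fun do rewrite exprS.
exact: cplx_ctsM.
Qed.
Lemma cplx_ctsJ z : cplx_cts z -> cplx_cts (fun x => (z x)^*).
Proof.
have E1 (a : C) : Re a^* = Re a by case: a.
have E2 (a : C) : Im a^* = - Im a by case: a.
move=> [z1 z2]; split; first by under eq_fun do rewrite E1.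
under eq_fun do rewrite E2; exact: ctsN.
Qed.
Lemma cplx_cts_real f : continuous f -> cplx_cts (fun x => (f x)%:C).
Proof. by move=> cf; split=> //=; exact: cts_cst. Qed.
Lemma cts_normsq z : cplx_cts z -> continuous (fun x => normsq (z x)).
Proof.
by case=> z1 z2; rewrite /normsq; apply: ctsD; under eq_fun do rewrite expr2;
   exact: ctsM.
Qed.


Ltac cts_poly := repeat match goal with
  | |- cplx_cts (fun x => Algebra.add (@?a x) (@?b x)) => apply: (@cplx_ctsD a b)
  | |- cplx_cts (fun x => Algebra.opp (@?a x)) => apply: (@cplx_ctsN a)
  | |- cplx_cts (fun x => GRing.mul (@?a x) (@?b x)) => apply: (@cplx_ctsM a b)
  | |- cplx_cts (fun x => GRing.exp (@?a x) ?n) => apply: (@cplx_ctsX n a)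
  | |- cplx_cts (fun x => conjc (@?a x)) => apply: (@cplx_ctsJ a)
  | H : cplx_cts ?a |- cplx_cts (fun x => ?a x) => exact: H
  end.

Lemma cplx_cts_unturned1 M x m y l0 l1 t0 t1 z w :
  cplx_cts x -> cplx_cts m -> cplx_cts y -> cplx_cts l0 -> cplx_cts l1 -> cplx_cts t0 -> cplx_cts t1 ->
  cplx_cts z -> cplx_cts w ->
  cplx_cts (fun p => unturned1 M (x p) (m p) (y p) (l0 p) (l1 p) (t0 p) (t1 p) (z p) (w p)).
Proof. by move=> *; rewrite /unturned1; cts_poly. Qed.

Lemma cplx_cts_unturned2 M x m y t0 t1 z w :
  cplx_cts x -> cplx_cts m -> cplx_cts y -> cplx_cts t0 -> cplx_cts t1 ->
  cplx_cts z -> cplx_cts w ->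
  cplx_cts (fun p => unturned2 M (x p) (m p) (y p) (t0 p) (t1 p) (z p) (w p)).
Proof. by move=> *; rewrite /unturned2; cts_poly. Qed.

Lemma cplx_cts_cone_map M z w f : cplx_cts z -> cplx_cts w -> continuous f ->
  cplx_cts (fun p => (cone_map M (z p, w p) (f p)).1) /\
  cplx_cts (fun p => (cone_map M (z p, w p) (f p)).2).
Proof.
move=> cz cw cf.
have crho := cts_normsq cz; have csg := cts_normsq cw.
have cr := cts_max crho csg; have c0 := @cts_cst 0.
have cB (a b : X -> R) : continuous a -> continuous b ->
    cplx_cts (fun p => (Num.max (a p - b p) 0)%:C).
  by move=> ca cb; apply: cplx_cts_real; apply: cts_max => //; apply: ctsD => //;
     exact: ctsN.
have c2 : continuous (fun p => 2 * Num.max (normsq (z p)) (normsq (w p))).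
  by apply: ctsM cr; exact: cts_cst.
have c3 : continuous (fun p => 3 * Num.max (normsq (z p)) (normsq (w p))).
  by apply: ctsM cr; exact: cts_cst.
have cx := cB _ _ crho csg; have cy := cB _ _ csg crho.
have cm := cplx_cts_real (cts_min crho csg).
have cl0 := cB _ _ cr cf; have cl1 := cplx_cts_real (cts_min cr cf).
have ct0 := cB _ _ cf cr; have ct1 := cB _ _ c2 cf.
have cu0 := cB _ _ c3 cf; have cu1 := cB _ _ cf c2.
have cA := cplx_cts_unturned1 M cx cm cy cl0 cl1 ct0 ct1 cz cw.
have cL := cplx_cts_unturned2 M cx cm cy ct0 ct1 cz cw.
split; rewrite /cone_map.
  apply: cplx_ctsD cu1; apply: cplx_ctsM cu0 _; apply: cplx_ctsD (cplx_ctsM ct0 cA) _.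
  exact: cplx_ctsN (cplx_ctsM ct1 cL).
apply: cplx_ctsM cu0 _; apply: cplx_ctsD (cplx_ctsM (cplx_ctsM cu1 cm) cw).
exact: cplx_ctsD (cplx_ctsM ct1 cA) (cplx_ctsM ct0 cL).
Qed.

Definition cplx_cts2 (v : X -> C * C) := cplx_cts (fun p => (v p).1) /\ cplx_cts (fun p => (v p).2).

Lemma cplx_cts_join_step M a v f : cplx_cts2 a -> cplx_cts2 v -> continuous f ->
  cplx_cts2 (fun p => join_step M (a p) (v p) (f p)).
Proof.
move=> [a1 a2] [v1 v2] cf; rewrite /join_step.
have [p1 p2] := cplx_cts_cone_map M (cplx_ctsM (cplx_ctsJ a1) v1) (cplx_ctsM (cplx_ctsJ a2) v2) cf.
by split; apply: cplx_ctsM.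
Qed.

Lemma cplx_cts_join_fold M (I : Type) (s : seq I) (t : I -> X -> R) (a : I -> X -> C * C) :
  (forall i, continuous (t i)) -> (forall i, cplx_cts2 (a i)) ->
  cplx_cts2 (fun p => join_fold M [seq (t i p, a i p) | i <- s]).
Proof.
move=> ct ca; elim/last_ind: s => [|s i IH].
  by split; split; exact: cts_cst.
under [X in cplx_cts2 X]eq_fun do rewrite map_rcons join_fold_rcons /=.
exact: cplx_cts_join_step.
Qed.

End Continuity.

Section MatrixContinuity.
Local Open Scope classical_set_scope.
Lemma cts_mx (R : realType) (X : topologicalType) m n (F : X -> 'M[R]_(m, n)) :
  (forall i j, continuous (fun x => F x i j)) -> continuous F.
Proof.
move=> cF x A [P nP sPA].
have : \forall z \near x, forall i j, P i j (F z i j).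
  apply: filter_forall => i; apply: filter_forall => j; apply: cF.
  exact: nP.
by apply: filterS => z Pz; apply: sPA.
Qed.
End MatrixContinuity.

(** * Roots of unity *)

Section Roots.
Variable R : realType.
Implicit Types (a b z w : R[i]) (p q : nat).

Lemma root_of_unity_exists p : (1 < p)%N ->
  exists2 a : R[i], a ^+ p = 1 & a != 1.
Proof.
move=> p_gt1; have : size (\poly_(i < p) (1 : R[i])) != 1%N.
  by rewrite size_poly_eq ?oner_eq0 //; case: p p_gt1 => [|[]].
move=> /closed_rootP[a]; rewrite /root horner_poly.
under eq_bigr do rewrite mul1r.
move=> /eqP a0; exists a.
  by apply/eqP; rewrite -subr_eq0 subrX1 a0 mulr0.
apply/eqP => a1; move: a0; rewrite a1.
under eq_bigr do rewrite expr1n.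
rewrite sumr_const card_ord => /eqP; rewrite pnatr_eq0.
by case: p p_gt1.
Qed.

Lemma root_of_unity_norm p a : (0 < p)%N -> a ^+ p = 1 -> a * a^* = 1.
Proof.
move=> p0 ap; apply/eqP; rewrite -(@pexpr_eq1 _ _ p) ?mulcJ_ge0 //.
by rewrite exprMn -conjcX ap mul1r conjc1.
Qed.

Lemma root_of_unity_coprime p q a : prime q -> ~~ (q %| p)%N ->
  a ^+ q = 1 -> a != 1 -> a ^+ p != 1.
Proof.
move=> q_pr qp aq a1; have [m am mq] := prim_order_exists (prime_gt0 q_pr) aq.
have /orP[/eqP m1|/eqP mE] : (m == 1%N) || (m == q).
  by case/primeP: q_pr => _; apply.
  by move: a1; rewrite -[a]expr1 -m1 prim_expr_order ?eqxx.
by rewrite -(prim_order_dvd am) mE.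
Qed.

(** A wave of period p and a wave of period q that cancel each other are both
    zero. Averaging over the translations by multiples of p kills the second
    one, so that Re (z conj(a^i)) = 0 for all i; taking i = 0 and i = 1 suffices
    as a is not real, p being odd. *)
Lemma wave_separates p q a b z w : odd p -> (0 < q)%N ->
    a ^+ p = 1 -> a != 1 -> a * a^* = 1 -> b ^+ q = 1 -> b ^+ p != 1 ->
    (forall i, Re (z * (a ^+ i)^*) + Re (w * (b ^+ i)^*) = 0) ->
  z = 0.
Proof.
move=> p_odd q_gt0 ap a1 aJ bq bp H.
have H0 i : Re (z * (a ^+ i)^*) = 0.
  have : \sum_(j < q) (Re (z * (a ^+ (i + p * j))^*) + Re (w * (b ^+ (i + p * j))^*)) = 0.
    by apply: big1 => j _; exact: H.
  rewrite big_split /=.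
  have -> : \sum_(j < q) Re (z * (a ^+ (i + p * j))^*) = q%:R * Re (z * (a ^+ i)^*).
    rewrite (eq_bigr (fun=> Re (z * (a ^+ i)^*))); last first.
      by move=> j _; rewrite exprD exprM ap expr1n mulr1.
    by rewrite sumr_const card_ord mulr_natl.
  have -> : \sum_(j < q) Re (w * (b ^+ (i + p * j))^*) =
            Re (w * (b ^+ i)^* * \sum_(j < q) ((b ^+ p)^*) ^+ j).
    rewrite mulr_sumr.
    have -> : Re (\sum_(j < q) w * (b ^+ i)^* * (b ^+ p)^* ^+ j) =
       \sum_(j < q) Re (w * (b ^+ i)^* * (b ^+ p)^* ^+ j).
      by elim/big_rec2: _ => /= [|j u v _ <-]; last by case: v; case: (_ * _).
    apply: eq_bigr => j _; rewrite exprD exprM -!conjcX.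
    by rewrite conjcM mulrA.
  have -> : \sum_(j < q) ((b ^+ p)^*) ^+ j = 0.
    have n0 : (b ^+ p)^* - 1 != 0.
      rewrite subr_eq0; apply: contra bp => /eqP bpJ.
      by rewrite -[b ^+ p]conjcK bpJ conjc1.
    apply: (mulfI n0); rewrite -subrX1 mulr0.
    by rewrite -conjcX -exprM mulnC exprM bq expr1n conjc1 subrr.
  rewrite mulr0 addr0 => /eqP; rewrite mulf_eq0 pnatr_eq0.
  by rewrite eqn0Ngt q_gt0 /= => /eqP.
have z1 : Re z = 0 by have := H0 0%N; rewrite expr0 conjc1 mulr1.
have ima : Im a != 0.
  apply/eqP => ia; have aC : a^* = a by case: (a) ia => u v /= ->; rewrite oppr0.
  have a2 : a ^+ 2 = 1 by rewrite expr2 -{2}aC.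
  move/eqP: a1; apply; rewrite -ap -[p]odd_double_half p_odd -mul2n.
  by rewrite exprD exprM a2 expr1n mulr1.
have := H0 1%N; rewrite expr1; case: z a z1 ima {H H0 ap a1 aJ} => z1 z2 [a1 a2] /=.
move=> -> a20; rewrite mul0r mulrN opprK add0r => /eqP.
by rewrite mulf_eq0 (negPf a20) orbF => /eqP ->.
Qed.
End Roots.

(** * Numbering the cosets *)

Section DihedralCosets.
Variables (n : nat) (x y : dihedral n).
Hypotheses (n_odd : odd n) (n_gt1 : (1 < n)%N).
Hypothesis xy_gen : <<[set x; y]>>%g = [set: dihedral n]%SET.
Hypotheses (x_pow : (x ^+ n = 1)%g) (y_pow : (y ^+ 2 = 1)%g).
Hypothesis yx_rel : (y * x = x^-1 * y)%g.
Local Open Scope group_scope.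

Lemma y_conj_x : x ^ y = x^-1.
Proof.
have yV : y^-1 = y by apply/eqP; rewrite eq_invg_mul; apply/eqP.
by rewrite conjgE yV mulgA yx_rel -mulgA -[y * y]/(y ^+ 2) y_pow mulg1.
Qed.

Lemma dihedral_split : (<[x]> * <[y]>)%g = [set: dihedral n].
Proof.
rewrite -norm_joinEr; first by rewrite -xy_gen joing_idl joing_idr.
rewrite cycle_subG; apply/normP.
by rewrite -cycleJ y_conj_x cycleV.
Qed.

(** This is where the parity of n enters the group theory. *)
Lemma cycles_TI : <[x]> :&: <[y]> = 1.
Proof.
apply: coprime_TIg; rewrite -!orderE.
apply: (@coprime_dvdr _ 2); first by rewrite order_dvdn y_pow.
apply: (@coprime_dvdl _ n); first by rewrite order_dvdn x_pow.
by rewrite coprimen2.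
Qed.

(** Counting: the two cyclic subgroups have orders at most n and 2, and their
    product has 2n elements. *)
Lemma order_x : #[x] = n.
Proof.
have := TI_cardMg cycles_TI; rewrite dihedral_split card_dihedral ?double_gt0 //.
rewrite -!orderE => cardE.
have xn : (#[x] <= n)%N by rewrite dvdn_leq ?order_dvdn ?x_pow // ltnW.
have y2 : (#[y] <= 2)%N by rewrite dvdn_leq // order_dvdn y_pow.
have := order_gt0 x; have := order_gt0 y.
by nia.
Qed.

Lemma coset_expP (C : lcoset_space <[y]>) : exists i, val C = x ^+ i *: <[y]>.
Proof.
have /lcosetsP[g _ ->] := valP C.
have : g \in <[x]> * <[y]> by rewrite dihedral_split inE.
move=> /mulsgP[_ v /cycleP[i ->] vy ->]; exists i.
by rewrite lcosetM (lcoset_id vy).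
Qed.

Lemma coset_exp_inj i j : x ^+ i *: <[y]> = x ^+ j *: <[y]> -> i = j %[mod n].
Proof.
move=> E; have : x ^+ i \in x ^+ j *: <[y]> by rewrite -E lcoset_refl.
rewrite mem_lcoset => iy; apply/eqP.
rewrite -order_x -eq_expg_mod_order.
have : (x ^+ j)^-1 * x ^+ i \in <[x]> :&: <[y]>.
  by rewrite inE iy andbT groupM ?groupV ?mem_cycle.
by rewrite cycles_TI inE -eq_mulVg1 eq_sym.
Qed.

(** The cosets form a copy of the integers mod n on which x acts as i |-> i + 1
    and y as i |-> -i; multiplication by n - 1 stands for negation. *)
Lemma coset_index : exists idx : lcoset_space <[y]> -> nat,
  (forall i, exists C, idx C = i %[mod n]) /\
  (forall C, idx (lcoset_act x C) = (idx C).+1 %[mod n]) /\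
  (forall g, exists i (c : bool), forall C,
     idx (lcoset_act g C) = (i + (if c then idx C * n.-1 else idx C))%N %[mod n]).
Proof.
have /choice[idx idxP] := coset_expP.
exists idx; split=> [i|]; last split=> [C|g].
  have Ci : x ^+ i *: <[y]> \in lcosets <[y]> [set: dihedral n].
    by apply/lcosetsP; exists (x ^+ i); rewrite ?inE.
  by exists (exist (fun D => is_true (D \in lcosets <[y]> [set: dihedral n])) _ Ci : lcoset_space <[y]>); apply: coset_exp_inj; rewrite -idxP.
  by apply: coset_exp_inj; rewrite -idxP /= lcosetE idxP -lcosetM -expgS.
have : g \in <[x]> * <[y]> by rewrite dihedral_split inE.
move=> /mulsgP[_ v /cycleP[i ->] /cycleP[j ->] gE]; exists i, (odd j) => C.
apply: coset_exp_inj; rewrite -idxP /= gE lcosetE idxP.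
have yj : y ^+ j = y ^+ odd j.
  by rewrite -[in LHS](odd_double_half j) expgD -[j./2.*2]mul2n expgM y_pow expg1n mulg1.
have yid : y *: <[y]> = <[y]> by rewrite lcoset_id ?cycle_id.
rewrite yj; case: (odd j); last by rewrite expg0 mulg1 -lcosetM -expgD.
rewrite expg1 -!lcosetM.
have -> : x ^+ i * y * x ^+ idx C = x ^+ (i + idx C * n.-1) * y.
  rewrite expgD -!mulgA; congr (_ * _).
  rewrite (mulnC (idx C)) expgM.
  have -> : x ^+ n.-1 = x^-1.
    by apply/eqP; rewrite eq_sym eq_invg_mul -expgS prednK ?x_pow // ltnW.
  rewrite -y_conj_x -conjXg conjgE.
  have yV : y^-1 = y by apply/eqP; rewrite eq_invg_mul; apply/eqP.
  by rewrite yV -!mulgA -[y * y]/(y ^+ 2) y_pow mulg1.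
by rewrite lcosetM yid.
Qed.
End DihedralCosets.

(** * Plane waves in the standard representation *)

Section Embedding.
Variables (R : realType) (n d : nat) (T : Type) (chi : T -> R[i] * R[i]).
Variable e : 'I_n -> T.
Implicit Types (v : R[i] * R[i]).

(** The embedding of V: the wave of v is its real inner product with the orbit
    point attached to each coset. *)
Definition wave v (c : T) : R := Re (v.1 * (chi c).1^*) + Re (v.2 * (chi c).2^*).

(** Only the first of the d copies of the representation is used. *)
Definition wave_mx v : 'M[R]_(d, n) :=
  \matrix_(a, i) (if a == 0%N :> nat then wave v (e i) else 0).

Definition wave_unit v := (euclid_norm (wave_mx v))^-1 *: wave_mx v.

Lemma euclid_norm_scale (c : R) (A : 'M[R]_(d, n)) :
  euclid_norm (c *: A) = `|c| * euclid_norm A.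
Proof.
rewrite /euclid_norm -sqrtr_sqr -sqrtrM ?sqr_ge0 //; congr Num.sqrt.
rewrite mulr_sumr; apply: eq_bigr => a _; rewrite mulr_sumr.
by apply: eq_bigr => i _; rewrite mxE exprMn.
Qed.

Lemma euclid_norm_eq0 (A : 'M[R]_(d, n)) : euclid_norm A = 0 -> A = 0.
Proof.
have rows_ge0 a : 0 <= \sum_i A a i ^+ 2 by apply: sumr_ge0 => i _; exact: sqr_ge0.
have sum_ge0 : 0 <= \sum_a \sum_i A a i ^+ 2 by exact: sumr_ge0.
move=> /eqP; rewrite sqrtr_eq0 => le0; apply/matrixP => a i; rewrite mxE.
have /eqP : \sum_a \sum_i A a i ^+ 2 = 0 by apply/eqP; rewrite eq_le le0.
rewrite psumr_eq0 // => /allP/(_ a); rewrite mem_index_enum => /(_ isT) /=.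
rewrite psumr_eq0; last by move=> *; exact: sqr_ge0.
move=> /allP/(_ i); rewrite mem_index_enum => /(_ isT) /=.
by rewrite sqrf_eq0 => /eqP.
Qed.

Lemma wave_unit_sphere v : wave_mx v != 0 -> \sum_i wave v (e i) = 0 ->
  unit_vectors R d n (wave_unit v).
Proof.
move=> v0 s0; split.
  move=> a; rewrite /std_rep /=.
  under eq_bigr do rewrite !mxE.
  by rewrite -mulr_sumr; case: (a == 0%N :> nat); rewrite ?s0 ?big1 ?mulr0.
have e0 : euclid_norm (wave_mx v) != 0.
  by apply: contra_neq v0 => /euclid_norm_eq0.
by rewrite euclid_norm_scale ger0_norm ?invr_ge0 ?sqrtr_ge0 // mulVf.
Qed.

Lemma wave_mx_twist c g v (s : 'S_n) : g.1 * g.1^* = 1 -> g.2 * g.2^* = 1 ->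
  (forall i, chi (e (s i)) = twist c g (chi (e i))) ->
  wave_mx (twist c g v) = perm_coord s (wave_mx v).
Proof.
move=> g1 g2 chis.
have E (u a b : R[i]) : u * u^* = 1 ->
    Re (u * conj_if c a * (u * conj_if c b)^*) = Re (a * b^*).
  move=> u1; rewrite conjcM conj_ifJ mulrACA u1 mul1r -conj_ifM.
  by case: c {chis}; case: (a * b^*).
apply/matrixP => a i; rewrite !mxE; case: (a == 0%N :> nat) => //.
by rewrite /wave -[i in LHS](permKV s) chis /twist /= !E.
Qed.

Lemma euclid_norm_perm (s : 'S_n) (A : 'M[R]_(d, n)) :
  euclid_norm (perm_coord s A) = euclid_norm A.
Proof.
rewrite /euclid_norm; congr Num.sqrt; apply: eq_bigr => a _.
rewrite (reindex_inj (@perm_inj _ s)).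
by apply: eq_bigr => i _; rewrite !mxE permK.
Qed.

Lemma wave_unit_twist c g v (s : 'S_n) : g.1 * g.1^* = 1 -> g.2 * g.2^* = 1 ->
  (forall i, chi (e (s i)) = twist c g (chi (e i))) ->
  wave_unit (twist c g v) = perm_coord s (wave_unit v).
Proof.
move=> g1 g2 chis; rewrite /wave_unit (wave_mx_twist v g1 g2 chis).
by rewrite euclid_norm_perm; apply/matrixP => a i; rewrite !mxE.
Qed.

Lemma cts_wave_unit (X : topologicalType) (F : X -> R[i] * R[i]) :
  (forall x, wave_mx (F x) != 0) -> cplx_cts2 F -> continuous (fun x => wave_unit (F x)).
Proof.
move=> F0 [F1 F2].
have cW c : continuous (fun x => wave (F x) c).
  have cc (z : R[i]) : cplx_cts (fun _ : X => z) by split; exact: cts_cst.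
  have [h1 _] := cplx_ctsM F1 (cc (chi c).1^*).
  have [h2 _] := cplx_ctsM F2 (cc (chi c).2^*).
  exact: ctsD h1 h2.
have cE a i : continuous (fun x => wave_mx (F x) a i).
  under eq_fun do rewrite mxE.
  by case: (a == 0%N :> nat); [exact: cW|exact: cts_cst].
have csum (I : finType) (f : I -> X -> R) : (forall i, continuous (f i)) ->
    continuous (fun x => \sum_i f i x).
  move=> cf; elim: (index_enum I) => [|i r IH].
    by under eq_fun do rewrite big_nil; exact: cts_cst.
  under eq_fun do rewrite big_cons.
  exact: ctsD.
have cnorm : continuous (fun x => euclid_norm (wave_mx (F x))).
  move=> x; apply: (continuous_comp (f := fun x => \sum_a \sum_i wave_mx (F x) a i ^+ 2)
     (g := @Num.sqrt R)); last exact: sqrt_continuous.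
  apply: (csum) => a; apply: (csum) => i.
  by under eq_fun do rewrite expr2; exact: ctsM.
apply: cts_mx => a i.
under eq_fun do rewrite mxE.
apply: ctsM; last exact: cE.
apply: ctsV => // x.
by apply: contra_neq (F0 x) => /euclid_norm_eq0.
Qed.
End Embedding.

(** A permutation of the cosets that multiplies both characters by numbers
    other than 1 shows that the characters sum to zero. *)
Lemma wave_sum_eq0 (R : realType) n (T : Type) (chi : T -> R[i] * R[i])
    (e : 'I_n -> T) (s : 'S_n) (a v : R[i] * R[i]) : a.1 != 1 -> a.2 != 1 ->
    (forall i, chi (e (s i)) = (a.1 * (chi (e i)).1, a.2 * (chi (e i)).2)) ->
  \sum_i wave chi v (e i) = 0.
Proof.
move=> a1 a2 chis.
have S0 (f : T -> R[i]) (u : R[i]) : u != 1 ->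
    (forall i, f (e (s i)) = u * f (e i)) -> \sum_i f (e i) = 0.
  move=> u1 fs; have n0 : u - 1 != 0 by rewrite subr_eq0.
  apply: (mulfI n0); rewrite mulr0 mulrBl mul1r mulr_sumr.
  rewrite [X in _ - X](reindex_inj (@perm_inj _ s)).
  by under [X in _ - X]eq_bigr do rewrite fs; rewrite subrr.
have ReS (w : R[i]) (f : T -> R[i]) :
    \sum_i Re (w * (f (e i))^*) = Re (w * (\sum_i f (e i))^*).
  rewrite rmorph_sum mulr_sumr; elim/big_rec2: _ => //= i z r _ ->.
  by rewrite -ReD.
rewrite /wave big_split /= (ReS v.1 (fun C => (chi C).1)).
rewrite (ReS v.2 (fun C => (chi C).2)).
rewrite (S0 (fun C => (chi C).1) a.1) => [|//|i]; last by rewrite chis.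
rewrite (S0 (fun C => (chi C).2) a.2) => [|//|i]; last by rewrite chis.
by rewrite conjc0 !mulr0 addr0.
Qed.

(** * The map on the join *)

Section Assembly.
Local Open Scope classical_set_scope.
Variables (R : realType) (M n k d : nat) (gT : finGroupType) (H : {set gT}).
Variables (e : 'I_n -> lcoset_space H) (e' : lcoset_space H -> 'I_n).
Hypotheses (eK : cancel e e') (e'K : cancel e' e).
Variable chi : lcoset_space H -> R[i] * R[i].
Hypothesis chi_rot : forall C, rotation M (chi C).
Hypothesis chi_act : forall g, exists2 h : R[i] * R[i],
  h.1 * h.1^* = 1 /\ h.2 * h.2^* = 1 &
  exists c, forall C, chi (lcoset_act g C) = twist c h (chi C).
Hypothesis wave_neq0 : forall v, v != 0 -> wave_mx d chi e v != 0.
Hypothesis wave_sum0 : forall v, \sum_i wave chi v (e i) = 0.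

Local Notation prejoin := (prejoin R (lcoset_space H) k).

Definition join_vec (P : prejoin) : R[i] * R[i] :=
  join_fold M [seq (val P.1 0 i, chi (P.2 i)) | i <- enum 'I_k].

Lemma join_vec_neq0 P : join_vec P != 0.
Proof.
apply/eqP => J0; have [t_ge0 t_sum] := set_mem (valP P.1).
have t0 i : val P.1 0 i = 0.
  have := join_fold_eq0 _ J0 (p := (val P.1 0 i, chi (P.2 i))).
  apply; last by apply/mapP; exists i; rewrite ?mem_enum.
  by move=> _ /mapP[j _ ->] /=; split; [exact: t_ge0|exact: chi_rot].
by move: t_sum; rewrite big1 // => /eqP; rewrite eq_sym oner_eq0.
Qed.

Lemma join_vec_sphere P : wave_unit d chi e (join_vec P) \in unit_vectors R d n.
Proof.
apply/mem_set/wave_unit_sphere; last exact: wave_sum0.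
exact/wave_neq0/join_vec_neq0.
Qed.

Definition prejoin_sphere P : sphere R d n :=
  exist (fun A : 'M[R]_(d, n) => A \in unit_vectors R d n) _ (join_vec_sphere P).

Lemma prejoin_sphere_compat (P Q : prejoin) :
  join_eq P Q -> prejoin_sphere P = prejoin_sphere Q.
Proof.
move=> /asboolP[E h]; apply: val_inj => /=; congr wave_unit.
rewrite /join_vec E; apply: join_fold_ext => // i.
by rewrite -E => /h ->.
Qed.

Lemma prejoin_sphere_continuous : continuous prejoin_sphere.
Proof.
apply: continuous_comp_initial.
apply: cts_wave_unit => [P|]; first exact/wave_neq0/join_vec_neq0.
apply: cplx_cts_join_fold => i.
  move=> P; apply: (continuous_comp (f := fun P : prejoin => val P.1)
    (g := fun t : 'rV[R]_k => t 0 i)); last exact: coord_continuous.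
  apply: (continuous_comp (f := fun P : prejoin => P.1) (g := set_val)).
    exact: cvg_fst.
  exact: initial_continuous.
have coset_cts (f : lcoset_space H -> R) : continuous (fun P : prejoin => f (P.2 i)).
  move=> P; apply: (continuous_comp (f := fun P : prejoin => P.2 i) (g := f)).
    apply: (continuous_comp (f := fun P : prejoin => P.2) (g := fun xs => xs i)).
      exact: cvg_snd.
    exact: (@proj_continuous _ (fun=> lcoset_space H) i).
  move=> A /nbhs_singleton fA.
  by rewrite nbhs_simpl /= nbhs_principalE; apply/principal_filterP.
split; split.
- exact: (coset_cts (fun C => Re (chi C).1)).
- exact: (coset_cts (fun C => Im (chi C).1)).
- exact: (coset_cts (fun C => Re (chi C).2)).
- exact: (coset_cts (fun C => Im (chi C).2)).
Qed.

Lemma prejoin_sphere_act (g : gT) P :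
  prejoin_sphere (prejoin_map (lcoset_act g) P) =
  sphere_act R d (coset_perm eK e'K g) (prejoin_sphere P).
Proof.
apply: val_inj => /=; have [h [h1 h2] [c chig]] := chi_act g.
rewrite -(@wave_unit_twist _ _ _ _ _ _ c h) //; last first.
  by move=> i; rewrite permE /= e'K chig.
congr wave_unit; rewrite -join_fold_twist // -map_comp; congr join_fold.
by apply: eq_map => i /=; rewrite chig.
Qed.

(** The topological conclusion, with the group theory reduced to a pair of
    characters chi of the cosets that the group permutes by twists. *)
Lemma join_sphere_map_exists : exists f : join R (lcoset_space H) k -> sphere R d n,
  equivariant_map (fun g : gT => join_map (lcoset_act g))
    (fun g : gT => sphere_act R d (coset_perm eK e'K g)) f.
Proof.
have piE (P Q : prejoin) : (\pi_(join R (lcoset_space H) k) P = \pi Q)%qT ->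
    prejoin_sphere P = prejoin_sphere Q.
  by move=> /eqmodP PQ; exact: prejoin_sphere_compat.
exists (prejoin_sphere \o repr); split.
  apply: repr_comp_continuous; first exact: prejoin_sphere_continuous.
  by move=> P Q /eqP /piE ->.
move=> g z /=; rewrite -prejoin_sphere_act; apply: piE.
by rewrite reprK.
Qed.
End Assembly.

Section DihedralMap.
Variables (R : realType) (n k d p q : nat).
Hypotheses (n_odd : odd n) (p_pr : prime p) (q_pr : prime q) (pq : p != q).
Hypotheses (pn : (p %| n)%N) (qn : (q %| n)%N) (d_gt0 : (0 < d)%N).
Variables x y : dihedral n.
Hypothesis xy_gen : <<[set x; y]>>%g = [set: dihedral n]%SET.
Hypotheses (x_pow : (x ^+ n = 1)%g) (y_pow : (y ^+ 2 = 1)%g).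
Hypothesis yx_rel : (y * x = x^-1 * y)%g.
Variables (e : 'I_n -> lcoset_space <[y]>%g) (e' : lcoset_space <[y]>%g -> 'I_n).
Hypotheses (eK : cancel e e') (e'K : cancel e' e).

Lemma dihedral_join_map :
  exists f : join R (lcoset_space <[y]>%g) k -> sphere R d n,
    equivariant_map
      (fun g : dihedral n => join_map (lcoset_act g))
      (fun g : dihedral n => sphere_act R d (coset_perm eK e'K g))
      f.
Proof.
have n_gt1 : (1 < n)%N.
  by apply: leq_trans (prime_gt1 p_pr) _; rewrite dvdn_leq ?odd_gt0.
have pq_co : coprime p q by rewrite prime_coprime // dvdn_prime2.
have [idx [idx_surj [idx_x idx_act]]] :=
  coset_index n_odd n_gt1 xy_gen x_pow y_pow yx_rel.
have [al alp al1] := root_of_unity_exists R (prime_gt1 p_pr).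
have [be beq be1] := root_of_unity_exists R (prime_gt1 q_pr).
have alJ := root_of_unity_norm (prime_gt0 p_pr) alp.
have beJ := root_of_unity_norm (prime_gt0 q_pr) beq.
have aln : al ^+ n = 1 by rewrite -(divnK pn) mulnC exprM alp expr1n.
have ben : be ^+ n = 1 by rewrite -(divnK qn) mulnC exprM beq expr1n.
(* M + 1 = 0 mod p and M = 0 mod q, that is, N = 0 mod p and N = 1 mod q. *)
pose M := chinese p q p.-1 0.
have alM : al ^+ M.+1 = 1.
  rewrite exprSr -(expr_mod M alp) chinese_modl // expr_mod //.
  by rewrite -exprSr prednK ?prime_gt0.
have beM : be ^+ M = 1 by rewrite -(expr_mod M beq) chinese_modr // mod0n.
pose chi (C : lcoset_space <[y]>%g) : R[i] * R[i] := (al ^+ idx C, be ^+ idx C).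
have unitX (u : R[i]) i : u * u^* = 1 -> u ^+ i * (u ^+ i)^* = 1.
  by move=> u1; rewrite conjcX -exprMn u1 expr1n.
have chi_rot C : rotation M (chi C).
  by split; rewrite /= ?unitX // exprAC ?alM ?beM expr1n.
have chi_act g : exists2 h : R[i] * R[i], h.1 * h.1^* = 1 /\ h.2 * h.2^* = 1 &
    exists c, forall C, chi (lcoset_act g C) = twist c h (chi C).
  have [i [c H]] := idx_act g; exists (al ^+ i, be ^+ i); first by split; exact: unitX.
  exists c => C.
  have E (u : R[i]) : u ^+ n = 1 -> u * u^* = 1 ->
      u ^+ idx (lcoset_act g C) = u ^+ i * conj_if c (u ^+ idx C).
    move=> un u1; rewrite -(expr_mod _ un) H expr_mod // exprD; congr (_ * _).
    case: (c) => //=; rewrite mulnC exprM conjcX; congr (_ ^+ _).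
    have u0 : u != 0 by apply: contra_eq_neq u1 => ->; rewrite mul0r eq_sym oner_eq0.
    by apply: (mulfI u0); rewrite -exprS prednK ?odd_gt0 // un u1.
  by rewrite /chi /twist /= !E.
have sum0 v : \sum_i wave chi v (e i) = 0.
  apply: (@wave_sum_eq0 _ _ _ _ _ (coset_perm eK e'K x) (al, be)) => // i.
  rewrite permE /= e'K /chi -(expr_mod _ aln) -(expr_mod (idx (lcoset_act x (e i))) ben).
  by rewrite idx_x (expr_mod _ aln) (expr_mod _ ben) !exprS.
apply: (@join_sphere_map_exists _ M) => // v.
apply: contra_neq => w0.
have H i : Re (v.1 * (al ^+ i)^*) + Re (v.2 * (be ^+ i)^*) = 0.
  have [C Ci] := idx_surj i.
  have := congr1 (fun A : 'M[R]_(d, n) => A (Ordinal d_gt0) (e' C)) w0.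
  rewrite !mxE /= /wave e'K /chi /=.
  rewrite -(expr_mod _ aln) -(expr_mod (idx C) ben) Ci.
  by rewrite (expr_mod _ aln) (expr_mod _ ben).
have p_odd : odd p by apply: dvdn_odd n_odd.
have q_odd : odd q by apply: dvdn_odd n_odd.
rewrite [v]surjective_pairing; congr (_, _).
  apply: (wave_separates p_odd (prime_gt0 q_pr) alp al1 alJ beq _ H).
  by apply: (root_of_unity_coprime q_pr _ beq be1); rewrite dvdn_prime2 // eq_sym.
apply: (wave_separates q_odd (prime_gt0 p_pr) beq be1 beJ alp (b := al) (w := v.1)).
  by apply: (root_of_unity_coprime p_pr _ alp al1); rewrite dvdn_prime2.
by move=> i; rewrite addrC.
Qed.
End DihedralMap.

End Construction.

Theorem corollary3p12 (R : realType) (n k d : nat)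
    (n_odd : odd n)
    (n_two_primes : exists p q : nat,
        [/\ prime p, prime q, p != q, p %| n & q %| n])
    (k_gt0 : 0 < k) (d_gt0 : 0 < d)
    (x y : dihedral n)
    (xy_gen : <<[set x; y]>>%g = [set: dihedral n]%SET)
    (x_pow : (x ^+ n = 1)%g) (y_pow : (y ^+ 2 = 1)%g)
    (yx_rel : (y * x = x^-1 * y)%g)
    (e : 'I_n -> lcoset_space <[y]>%g) (e' : lcoset_space <[y]>%g -> 'I_n)
    (eK : cancel e e') (e'K : cancel e' e) :
  exists f : join R (lcoset_space <[y]>%g) k ->
             sphere R d n,
    equivariant_map
      (fun g : dihedral n => join_map (lcoset_act g))
      (fun g : dihedral n => sphere_act R d (coset_perm eK e'K g))
      f.
Proof.
have [p [q [p_pr q_pr pq pn qn]]] := n_two_primes.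
exact: (@dihedral_join_map R n k d p q n_odd p_pr q_pr pq pn qn d_gt0
  x y xy_gen x_pow y_pow yx_rel e e' eK e'K).
Qed.
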